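(* Let $E:=\ell^1(\mathbb{N},\mathbb{C})$ be the space of absolutely summable complex sequences with its usual norm $\|\cdot\|_1$. Define $$g\colon E\to\mathbb{C},\qquad g(x):=\sum_{k=1}^\infty 2^k (x_k)^{2k}\quad\text{for } x=(x_k)_{k\in\mathbb{N}}\in E,$$ and $f\colon E\to\mathbb{C}^{\mathbb{N}}$, $f(x):=(g(nx))_{n\in\mathbb{N}}$. Then the map $f\colon E\to\mathbb{C}^{\mathbb{N}}$ is complex analytic, and it is unbounded on each non-empty open subset of $E$ (that is, $f(U)$ is an unbounded subset of $\mathbb{C}^{\mathbb{N}}$ for each non-empty open $U\subseteq E$).
   Context: $\mathbb{N}=\{1,2,\ldots\}$. $\mathbb{C}^{\mathbb{N}}$ is the space of all complex sequences with the product topology, a complex locally convex space; boundedness is meant in the sense of topological vector spaces. A map $f\colon U\to F$ from an open subset $U$ of a complex locally convex space $E$ to a complex locally convex space $F$ is called complex analytic if $f$ is continuous and for each $x\in U$ there exist a $0$-neighbourhood $Y\subseteq U-x$ and continuous, complex homogeneous polynomials $p_n\colon E\to F$ of degree $n$ ($n\in\mathbb{N}_0$) such that $f(x+y)=\sum_{n=0}^\infty p_n(y)$ for all $y\in Y$, with pointwise convergence. *)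

(* Defs.v *)
From HB Require Import structures.
From mathcomp Require Import all_boot all_order all_algebra.
From mathcomp Require Import finmap complex.
From mathcomp Require Import all_classical all_reals all_analysis.

Set Implicit Arguments.
Unset Strict Implicit.
Unset Printing Implicit Defensive.

Import Order.TTheory GRing.Theory Num.Theory numFieldNormedType.Exports.
Import ComplexField.Normc.

Local Open Scope classical_set_scope.
Local Open Scope ring_scope.
Local Open Scope complex_scope.

(* The library puts no topology on R[i]: take the one of its norm. *)
HB.instance Definition _ (R : rcfType) := NormedModule.copy R[i] (R[i])^o.

Definition multilinear (K : numDomainType) (E F : lmodType K) (n : nat)
    (b : ('I_n -> E) -> F) : Prop :=
  forall (v : 'I_n -> E) (i : 'I_n) (a : K) (x y : E),
    b (dfwith v i (a *: x + y)) = a *: b (dfwith v i x) + b (dfwith v i y).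

(* The n-linear map b need be neither symmetric nor continuous; for n = 0,
   p is an arbitrary constant map. *)
Definition homogeneous_polynomial (K : numDomainType) (E F : lmodType K)
    (n : nat) (p : E -> F) : Prop :=
  exists2 b : ('I_n -> E) -> F, multilinear b & forall x, p x = b (fun=> x).

(* Only the values of f on U matter. *)
Definition complex_analytic (R : realType) (E F : tvsType R[i])
    (U : set E) (f : E -> F) : Prop :=
  [/\ open U, {within U, continuous f} &
    forall x, U x -> exists (Y : set E) (p : nat -> E -> F),
      [/\ nbhs 0 Y,
          forall y, Y y -> U (x + y),
          forall n, homogeneous_polynomial n (p n) /\ continuous (p n) &
          forall y, Y y -> series (p ^~ y) @ \oo --> f (x + y)]].

(* Boundedness in the sense of topological vector spaces; the library's
   bounded_set is about norms. *)
Definition tvs_bounded (K : numFieldType) (E : tvsType K) (B : set E) : Prop :=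
  forall V : set E, nbhs 0 V -> exists2 r : K, 0 < r & B `<=` *:%R r @` V.

Section ptws_tvs.
Context (K : numFieldType) (I : Type) (E : tvsType K).

HB.instance Definition _ := GRing.Lmodule.copy {ptws I -> E} (I -> E).

Let ptws_continuous (X : topologicalType) (h : X -> {ptws I -> E}) :
  (forall i, continuous (fun x => h x i)) -> continuous h.
Proof.
move=> hc x; apply/cvg_sup => i.
exact: (@continuous_comp_initial _ _ _ (fun f : I -> E => f i) h (hc i)).
Qed.

Let ptws_proj_continuous (i : I) : continuous (fun f : {ptws I -> E} => f i).
Proof.
move=> f A fA; have /cvg_sup/(_ i) fc : f --> f by exact: cvg_id.
apply: fc; exact: (@initial_continuous _ _ (fun f : I -> E => f i) f).
Qed.

Let ptws_add_continuous :
  continuous (fun z : {ptws I -> E} * {ptws I -> E} => z.1 + z.2).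
Proof.
apply: ptws_continuous => i z.
apply: (@continuous_comp _ _ _
  (fun z : {ptws I -> E} * {ptws I -> E} => (z.1 i, z.2 i)) (fun z => z.1 + z.2)).
  apply: cvg_pair => /=.
    apply: (@continuous_comp _ _ _ fst (fun f : {ptws I -> E} => f i)).
      exact: cvg_fst.
    exact: ptws_proj_continuous.
  apply: (@continuous_comp _ _ _ snd (fun f : {ptws I -> E} => f i)).
      exact: cvg_snd.
    exact: ptws_proj_continuous.
exact: add_continuous.
Qed.

Let ptws_scale_continuous :
  continuous (fun z : K^o * {ptws I -> E} => z.1 *: z.2).
Proof.
apply: ptws_continuous => i z.
apply: (@continuous_comp _ (K^o * E)%type _
  (fun z : K^o * {ptws I -> E} => (z.1, z.2 i)) (fun z : K^o * E => z.1 *: z.2)).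
  apply: (@cvg_pair _ _ _ _ (nbhs (z.1 : K^o))) => /=; first exact: cvg_fst.
  apply: (@continuous_comp _ _ _ snd (fun f : {ptws I -> E} => f i)).
      exact: cvg_snd.
    exact: ptws_proj_continuous.
exact: scale_continuous.
Qed.

Let ptws_locally_convex : exists2 B : set_system {ptws I -> E},
  (forall b, b \in B -> convex_set b) & basis B.
Proof.
exists [set U | open U /\ convex_set U]; first by move=> b /[!inE] -[].
split=> [U [] //|f A /=].
have [Bc Bcc [Bo Bb]] := @locally_convex K E.
rewrite nbhsE => -[_ [[/= D sD <-] [C DC Cf]] DA].
have /sD [F sF FC] := DC.
have /choice[W HW] (V : set (I -> E)) : exists W : set {ptws I -> E},
    V \in F -> [/\ open W, convex_set W, W f & W `<=` V].
  have [VF|?] := boolP (V \in F); last by exists setT.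
  have /set_mem [j _ [G oG GV]] := sF _ VF.
  have Vf : V f by move: Cf; rewrite -FC; exact.
  have Gfj : nbhs (f j) G.
    by apply: open_nbhs_nbhs; split=> //; move: Vf; rewrite -GV.
  have [b /= [Bcb bfj] bG] := Bb _ _ Gfj.
  exists ((fun g : I -> E => g j) @^-1` b) => _; split => //.
  - apply: open_comp; last exact: Bo.
    by move=> g _; exact: ptws_proj_continuous.
  - move=> x y l /[!inE] xb yb.
    by apply/set_mem/(Bcc b); exact/mem_set.
  - by rewrite -GV => g /bG.
exists (\bigcap_(V in [set` F]) W V).
  split; first split.
  - rewrite openE => g Wg; apply: filter_bigI => V /= VF.
    by apply: open_nbhs_nbhs; split; [have [] := HW V VF|exact: Wg].
  - move=> x y l /[!inE] xW yW V /= VF; have [_ cW _ _] := HW V VF.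
    by apply/set_mem/cW; apply/mem_set; [exact: xW|exact: yW].
  - by move=> V /= VF; have [] := HW V VF.
move=> g Wg; apply: DA; exists C => //.
rewrite -FC => V /= VF; have [_ _ _] := HW V VF; apply; exact: Wg.
Qed.

HB.instance Definition _ := PreTopologicalNmodule_isTopologicalNmodule.Build
  {ptws I -> E} ptws_add_continuous.
HB.instance Definition _ := TopologicalNmodule_isTopologicalLmodule.Build
  K {ptws I -> E} ptws_scale_continuous.
HB.instance Definition _ :=
  Uniform_isTvs.Build K {ptws I -> E} ptws_locally_convex.
End ptws_tvs.

Section complex_limits.
Context {R : realType}.

Lemma Re_continuous : continuous (@complex.Re R : R[i] -> R).
Proof.
move=> z; apply/(@cvgrPdist_lt _ _ _ (nbhs z) (nbhs_filter z)) => e e0; near=> w.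
rewrite -ltcR; apply: (@le_lt_trans _ _ `|z - w|).
  by rewrite -raddfB; exact: normc_ge_Re.
by near: w; exists e%:C => /=; first by rewrite ltcR.
Unshelve. all: by end_near. Qed.

Lemma Im_continuous : continuous (@complex.Im R : R[i] -> R).
Proof.
move=> z.
have -> : (@complex.Im R : R[i] -> R) = (@complex.Re R) \o ( *%R^~ (- 'i)).
  by apply/funext => w /=; rewrite mulrN raddfN /= ReiNIm opprK.
apply: (@continuous_comp R[i] R[i] R ( *%R^~ (- 'i : R[i])) (@complex.Re R));
  last exact: Re_continuous.
  exact: mulrr_continuous.
Qed.

Lemma real_complex_continuous : continuous (real_complex R : R -> R[i]).
Proof.
move=> x; apply/cvgrPdist_lt => e e0.
have eE : e = (complex.Re e)%:C by rewrite RRe_real// gtr0_real.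
near=> y.
rewrite -raddfB /= normc_def /= expr0n/= addr0 sqrtr_sqr eE ltcR.
by near: y; exists (complex.Re e) => //=; rewrite -ltcR -eE.
Unshelve. all: by end_near. Qed.

End complex_limits.

Definition abs_summable {R : realType} : {pred nat -> R[i]} :=
  mem [set x : nat -> R[i] | cvgn [normed series x]].

Section abs_summable.
Context {R : realType}.
Implicit Types x y : nat -> R[i].

Let normc_ge0 (z : R[i]) : 0 <= normc z.
Proof. by case: z => a b; exact: sqrtr_ge0. Qed.

Let normed_seriesE x :
  [normed series x] = real_complex R \o series (fun k => normc (x k)).
Proof. by apply/funext => n; rewrite /series /= raddf_sum. Qed.

Lemma abs_summableP x :
  (x \in abs_summable) <-> cvgn (series (fun k => normc (x k))).
Proof.
rewrite inE /= normed_seriesE; split=> xc.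
  exact/cvgP/(cvg_comp _ _ xc (@Re_continuous R _)).
apply/cvgP; apply: (cvg_comp _ _ xc); exact: real_complex_continuous.
Qed.

Lemma lim_normed_series x : x \in abs_summable ->
  limn [normed series x] = (limn (series (fun k => normc (x k))))%:C.
Proof.
move=> /abs_summableP xc; apply: (@cvg_lim (R[i])^o) => //.
rewrite normed_seriesE; apply: (cvg_comp _ _ xc).
exact: real_complex_continuous.
Qed.

Lemma abs_summable_submod_closed : GRing.submod_closed (@abs_summable R).
Proof.
split=> [|a x y /abs_summableP xc /abs_summableP yc]; apply/abs_summableP.
  rewrite (_ : series _ = cst 0); first exact: is_cvg_cst.
  apply/funext => n; rewrite /series /= big1// => k _; exact: normc0.
have := is_cvg_seriesD (is_cvg_seriesZ (k := normc a) xc) yc.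
apply: series_le_cvg => k //=.
  by rewrite addr_ge0// mulr_ge0.
by apply: le_trans (le_normcD _ _) _; rewrite normcM.
Qed.

HB.instance Definition _ := GRing.isSubmodClosed.Build R[i] (nat -> R[i])
  (@abs_summable R) abs_summable_submod_closed.

End abs_summable.

Record ell1 (R : realType) :=
  Ell1 { ell1_seq :> nat -> R[i]; ell1_summable : ell1_seq \in abs_summable }.

HB.instance Definition _ (R : realType) := [isSub for @ell1_seq R].
HB.instance Definition _ (R : realType) := [Choice of ell1 R by <:].
HB.instance Definition _ (R : realType) :=
  [SubChoice_isSubLmodule of ell1 R by <:].

Definition ell1_norm (R : realType) (x : ell1 R) : R[i] :=
  limn [normed series x].

Section ell1_normed.
Context {R : realType}.
Implicit Types x y : ell1 R.

Let normc_ge0 (z : R[i]) : 0 <= normc z.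
Proof. by case: z => a b; exact: sqrtr_ge0. Qed.

Let ell1_normcP x : cvgn (series (fun k => normc (x k))).
Proof. exact/abs_summableP/ell1_summable. Qed.

Let ell1_normE x :
  ell1_norm x = (limn (series (fun k => normc (x k))))%:C.
Proof. exact: lim_normed_series (ell1_summable x). Qed.

Let ell1_normD x y : ell1_norm (x + y) <= ell1_norm x + ell1_norm y.
Proof.
rewrite !ell1_normE -raddfD /= lecR -(lim_seriesD (@ell1_normcP x) (@ell1_normcP y)).
apply: ler_lim; first exact: (@ell1_normcP (x + y)).
  exact: (is_cvg_seriesD (@ell1_normcP x) (@ell1_normcP y)).
by apply: nearW => n; apply: ler_sum => k _; exact: le_normcD.
Qed.

Let ell1_normZ (a : R[i]) x : ell1_norm (a *: x) = `|a| * ell1_norm x.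
Proof.
rewrite !ell1_normE -[ `|a| ]/((normc a)%:C) -rmorphM /=; congr (_%:C).
rewrite -[RHS](lim_seriesZ (normc a) (@ell1_normcP x)); congr (limn (series _)).
by apply/funext => k; exact: normcM.
Qed.

Let ell1_norm0_eq0 x : ell1_norm x = 0 -> x = 0.
Proof.
rewrite ell1_normE => /complexI x0; apply/val_inj/funext => k /=.
apply: eq0_normc; apply/eqP; rewrite eq_le normc_ge0 andbT -x0.
have nd : {homo series (fun k => normc (x k)) : n m / (n <= m)%N >-> n <= m}.
  by apply/nondecreasing_seqP => n; rewrite seriesSr lerDl.
apply: le_trans (nondecreasing_cvgn_le nd (@ell1_normcP x) k.+1).
by rewrite seriesSr lerDr; apply: sumr_ge0.
Qed.

HB.instance Definition _ :=
  Lmodule_isNormed.Build R[i] (ell1 R) ell1_normD ell1_normZ ell1_norm0_eq0.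

End ell1_normed.

(* The coordinate x_(k+1) of the 1-indexed sequence is x k; hence the shifts
   by one in the two definitions below. *)
Definition g_ell1 (R : realType) (x : ell1 R) : R[i] :=
  limn (series (fun k => 2 ^+ k.+1 * x k ^+ (2 * k.+1))).

Lemma g_ell1_cvg (R : realType) (x : ell1 R) :
  series (fun k => 2 ^+ k.+1 * x k ^+ (2 * k.+1)) @ \oo --> g_ell1 x.
Proof.
pose a k := normc (x k); pose u k : R[i] := 2 ^+ k.+1 * x k ^+ (2 * k.+1).
have a0 k : 0 <= a k by rewrite /a; case: (x k) => b c; exact: sqrtr_ge0.
have nu0 k : 0 <= normc (u k) by case: (u k) => b c; exact: sqrtr_ge0.
have ac : cvgn (series a) by exact/abs_summableP/ell1_summable.
have normcX (z : R[i]) n : normc (z ^+ n) = normc z ^+ n.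
  by elim: n => [|n ih]; rewrite ?expr0 ?normc1// !exprS normcM ih.
have n2 : normc (2 : R[i]) = 2 :> R by rewrite (normcMn 1 2) normc1.
have uE k : normc (u k) = (2 * a k ^+ 2) ^+ k.+1.
  by rewrite /u normcM !normcX n2 exprM [RHS]exprMn.
have /cvgrPdist_le/(_ 2^-1) := cvg_series_cvg_0 ac.
rewrite invr_gt0 ltr0n => /(_ isT)[N _ aN].
have ua k : (N <= k)%N -> normc (u k) <= a k.
  move=> Nk; have := aN k Nk; rewrite /= sub0r normrN ger0_norm// => ak.
  have le2a : 2 * a k ^+ 2 <= a k.
    by rewrite expr2 mulrA ler_piMl// mulrC -ler_pdivlMr// mul1r.
  rewrite uE; apply: (le_trans _ le2a); rewrite exprS ler_piMr ?exprn_ile1//.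
  - by rewrite mulr_ge0// sqr_ge0.
  - by rewrite mulr_ge0// sqr_ge0.
  - by apply: (le_trans le2a); apply: (le_trans ak); rewrite invf_le1// ler1n.
have uc : cvgn (series (fun k => normc (u k))).
  pose w k := if (N <= k)%N then normc (u k) else 0.
  have wc : cvgn (series w).
    apply: (series_le_cvg _ a0 _ ac) => k; rewrite /w; case: ifP => //.
    by move=> Nk; exact: ua.
  rewrite -(is_cvg_series_restrict N); rewrite -(is_cvg_series_restrict N) in wc.
  rewrite (_ : (fun n => _) = (fun n => \sum_(N <= k < n) w k))//.
  apply/funext => n; apply: eq_big_nat => k /andP[Nk _].
  by rewrite /w Nk.
have part (h : R[i] -> R) : (forall z, `|h z| <= normc z) ->
    cvgn (series (fun k => h (u k))).
  move=> hn; apply: (@normed_cvg R R^o).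
  by apply: (series_le_cvg _ nu0 _ uc) => k /=.
have Rec := part (@complex.Re R) _; have Imc := part (@complex.Im R) _.
have {}Rec : cvgn (series (fun k => complex.Re (u k))).
  by apply: Rec => z; rewrite -lecR; exact: normc_ge_Re.
have {}Imc : cvgn (series (fun k => complex.Im (u k))).
  by apply: Imc => -[b c] /=; rewrite -sqrtr_sqr ler_wsqrtr// lerDr sqr_ge0.
have sE : series u = (fun n => (series (fun k => complex.Re (u k)) n)%:C +
    'i * (series (fun k => complex.Im (u k)) n)%:C).
  apply/funext => n; rewrite /series /= !raddf_sum mulr_sumr -big_split /=.
  by apply: eq_bigr => k _; exact: complexE.
suff h : cvgn (series u) by exact: h.
rewrite sE; apply: (@is_cvgD R[i] R[i]^o).
  exact/cvgP/(cvg_comp _ _ Rec (@real_complex_continuous R _)).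
apply: (@is_cvgMl_tmp R[i]).
exact/cvgP/(cvg_comp _ _ Imc (@real_complex_continuous R _)).
Qed.

Definition f_ell1 (R : realType) (x : ell1 R) : {ptws nat -> R[i]} :=
  fun n => g_ell1 (n.+1%:R *: x).

(* Main.v *)
(** Since the coordinates of x and y in l^1 tend to 0, eventually
  |x_k| + |y_k| <= 1/2, and then 2^k (|x_k| + |y_k|)^(2k) <= 2^-k. Hence the
  binomial expansion of g(x + y) in powers of y, and each of its homogeneous
  parts, is eventually dominated by a geometric series, locally uniformly in y.
  So for each n the expansion of g(n(x + y)) is valid for all y in l^1, and Y can
  be the whole space for all coordinates of f simultaneously.  For
  unboundedness, fix a ball of radius e about x and n with n e/2 >= 1: changing
  x_k to e/2 stays inside the ball for all large k, and changes g(nx) by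
  2^k (n e/2)^(2k) - 2^k (n x_k)^(2k), which is at least 2^k - 1. *)

Require Import Defs.
From mathcomp Require Import all_boot all_order all_algebra.
From mathcomp Require Import complex.
From mathcomp Require Import all_classical all_reals all_analysis.

Set Implicit Arguments.
Unset Strict Implicit.
Unset Printing Implicit Defensive.

Import Order.TTheory GRing.Theory Num.Theory numFieldNormedType.Exports.

Local Open Scope classical_set_scope.
Local Open Scope ring_scope.

(** * Limits and geometric bounds for complex series *)

Lemma norm_lim_le (K : numFieldType) (V : normedModType K) (u : nat -> V)
    (l a : V) (c : K) :
  u @ \oo --> l -> (\forall n \near \oo, `|u n - a| <= c) -> `|l - a| <= c.
Proof.
move=> /cvgrPdist_lt ul ua; apply/ler_addgt0Pl => e e0.
near \oo => n.
rewrite -(subrKA (u n)) (le_trans (ler_normD _ _))// lerD//.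
  by apply: ltW; near: n; exact: ul.
by near: n.
Unshelve. all: by end_near. Qed.

Lemma near_half_expr_lt (R : realType) (e : R[i]) : 0 < e ->
  \forall n \near \oo, 2^-1 ^+ n < e.
Proof.
case: e => a b; rewrite ltcE /= => /andP[/eqP -> a0].
have h : `|2^-1 : R| < 1 by rewrite ger0_norm ?invr_ge0// invf_lt1 ?ltr1n.
have /cvgr0_norm_lt/(_ _ a0) := cvg_expr h.
apply: filterS => n /=; rewrite ger0_norm ?exprn_ge0 ?invr_ge0// => na.
have -> : (2^-1 ^+ n : R[i]) = ((2^-1 ^+ n : R)%:C)%C.
  by rewrite rmorphXn fmorphV rmorphMn.
by rewrite ltcR.
Qed.

(** Real and imaginary parts are each bounded by [|u k|], so both converge absolutely in [R] by
    comparison with a geometric series. *)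
Lemma cvg_series_half (R : realType) (N : nat) (u : nat -> R[i]) :
  (forall k, (N <= k)%N -> `|u k| <= 2^-1 ^+ k.+1) -> cvgn (series u).
Proof.
move=> uN.
have part (h : R[i] -> R) : (forall z, (`|h z|%:C)%C <= `|z|) ->
    cvgn (series (fun k => h (u k))).
  move=> hn; rewrite -(is_cvg_series_restrict N).
  (* Cutting off the first [N] terms, which carry no bound, lets the comparison hold for every
     index. *)
  pose w k := if (N <= k)%N then h (u k) else 0.
  rewrite (_ : (fun n => _) = (fun n => \sum_(N <= k < n) w k)); last first.
    by apply/funext => n; apply: eq_big_nat => k /andP[Nk _]; rewrite /w Nk.
  rewrite (is_cvg_series_restrict N w); apply: (@normed_cvg R R^o).
  have h1 : `|2^-1 : R| < 1 by rewrite ger0_norm ?invr_ge0// invf_lt1 ?ltr1n.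
  have gc := @is_cvg_geometric_series _ 2^-1 2^-1 h1.
  apply: (series_le_cvg _ _ _ gc) => k //=.
  rewrite -exprS /w; case: ifPn => Nk; last first.
    by rewrite normr0 exprn_ge0 ?invr_ge0.
  rewrite -lecR; apply: le_trans (hn _) _; apply: le_trans (uN _ Nk) _.
  by rewrite rmorphXn fmorphV rmorphMn.
have Rec : cvgn (series (fun k => complex.Re (u k))).
  by apply: part => z; exact: normc_ge_Re.
have Imc : cvgn (series (fun k => complex.Im (u k))).
  apply: part => -[b c] /=.
  by rewrite lecR -sqrtr_sqr ler_wsqrtr// lerDr sqr_ge0.
have -> : series u = (fun n => ((series (fun k => complex.Re (u k)) n)%:C)%C +
    'i%C * ((series (fun k => complex.Im (u k)) n)%:C)%C).
  apply/funext => n; rewrite /series /= !raddf_sum mulr_sumr -big_split /=.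
  by apply: eq_bigr => k _; exact: complexE.
apply: (@is_cvgD R[i] R[i]^o).
  exact/cvgP/(cvg_comp _ _ Rec (@real_complex_continuous R _)).
apply: (@is_cvgMl_tmp R[i]).
exact/cvgP/(cvg_comp _ _ Imc (@real_complex_continuous R _)).
Qed.

(** Telescoping: 2^-(k+1) = 2^-k - 2^-(k+1). *)
Lemma sum_half_le (K : numFieldType) (n m : nat) :
  \sum_(n <= k < m) 2^-1 ^+ k.+1 <= 2^-1 ^+ n :> K.
Proof.
have [nm|/ltnW mn] := leqP n m; last by rewrite big_geq// exprn_ge0 ?invr_ge0.
suff -> : \sum_(n <= k < m) 2^-1 ^+ k.+1 = 2^-1 ^+ n - 2^-1 ^+ m :> K.
  by rewrite lerBlDr lerDl exprn_ge0 ?invr_ge0.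
have := telescope_sumr (fun k => - (2^-1 : K) ^+ k) nm.
rewrite opprK addrC => <-; apply: eq_bigr => k _.
by rewrite opprK exprS mulrC [X in _ = _ + X]splitr addKr.
Qed.

(** The error bound does not depend on [u]; this is what gives uniform convergence later. *)
Lemma series_half_tail (R : realType) (n : nat) (u : nat -> R[i]) :
  (forall k, (n <= k)%N -> `|u k| <= 2^-1 ^+ k.+1) ->
  `|limn (series u) - series u n| <= 2^-1 ^+ n.
Proof.
move=> un; apply: (@norm_lim_le _ R[i] (series u)); first exact: cvg_series_half un.
exists n => // m /= nm; rewrite sub_series_geq//.
apply: le_trans (ler_norm_sum _ _ _) _; apply: le_trans (sum_half_le _ n m).
by rewrite !big_nat; apply: ler_sum => k /andP[nk _]; exact: un.
Qed.

(** * Coordinates in l^1 and continuity of coordinatewise series *)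

Lemma ell1_scaleE (R : realType) (a : R[i]) (x : ell1 R) (k : nat) :
  (a *: x) k = a * x k.
Proof. by []. Qed.

Lemma ell1_coord_cvg0 (R : realType) (x : ell1 R) :
  (x : nat -> R[i]) @ \oo --> (0 : R[i]).
Proof.
have := ell1_summable x; rewrite inE => /cvg_series_cvg_0.
move=> xc; apply/cvgr0Pnorm_lt => e e0; move/cvgr0Pnorm_lt/(_ e e0) : xc.
by apply: filterS => k; rewrite normr_id.
Qed.

Lemma near_ell1_coord_lt (R : realType) (e : R[i]) (x : ell1 R) : 0 < e ->
  \forall k \near \oo, `|x k| < e.
Proof. by move=> e0; have /cvgr0Pnorm_lt := ell1_coord_cvg0 x; exact. Qed.

Lemma near_ell1_small (R : realType) (j : nat) (e : R[i]) (x : ell1 R)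
    (v : 'I_j -> ell1 R) : 0 < e ->
  \forall k \near \oo, `|x k| + \sum_(i < j) `|v i k| <= e.
Proof.
(* One share of [e] for [x] and one for each of the [j] vectors. *)
move=> e0; pose d := e / j.+1%:R.
have d0 : 0 < d by rewrite divr_gt0.
have vsmall : \forall k \near \oo, forall i, `|v i k| < d.
  by apply: filter_forall => i; exact: near_ell1_coord_lt.
near=> k.
have -> : e = d + \sum_(i < j) d.
  by rewrite sumr_const card_ord -mulrS -mulr_natr divfK.
apply: lerD; first by apply: ltW; near: k; exact: near_ell1_coord_lt.
apply: ler_sum => i _; apply: ltW; move: i; near: k; exact: vsmall.
Unshelve. all: by end_near. Qed.

Lemma ell1_coord_le_norm (R : realType) (x : ell1 R) (k : nat) : `|x k| <= `|x|.
Proof.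
apply: le_trans (_ : ell1_norm x <= _); last by [].
have /abs_summableP xc := ell1_summable x.
rewrite /ell1_norm lim_normed_series ?ell1_summable// lecR.
have nd : {homo series (fun k => ComplexField.Normc.normc (x k)) :
    n m / (n <= m)%N >-> n <= m}.
  apply/nondecreasing_seqP => n; rewrite seriesSr lerDl.
  by case: (x n) => a b; exact: sqrtr_ge0.
apply: le_trans (nondecreasing_cvgn_le nd xc k.+1).
rewrite seriesSr lerDr; apply: sumr_ge0 => i _.
by case: (x i) => a b; exact: sqrtr_ge0.
Qed.

Lemma near_ell1_dist_lt (R : realType) (x : ell1 R) (e : R[i]) :
  0 < e -> \forall y \near x, `|x - y| < e.
Proof. by move=> e0; move: (cvg_id (F:= nbhs x)) => /cvgrPdist_lt/(_ e e0). Qed.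

Lemma ell1_coord_continuous (R : realType) (k : nat) :
  continuous (fun x : ell1 R => x k).
Proof.
move=> x; apply/(@cvgrPdist_lt _ _ _ (nbhs x) (nbhs_filter x)) => e e0; near=> y.
apply: (@le_lt_trans _ _ `|x - y|); first exact: (ell1_coord_le_norm (x - y) k).
by near: y; exact: near_ell1_dist_lt.
Unshelve. all: by end_near. Qed.

(* The hypothesis is uniform in y near each point: x_k and (y0)_k tend to 0, and
   |y_k - (y0)_k| <= |y - y0| for all k at once. *)
Lemma series_continuous (R : realType) (x : ell1 R) (c : R[i])
    (u : nat -> ell1 R -> R[i]) : 0 <= c ->
  (forall k, continuous (u k)) ->
  (forall k (y : ell1 R), `|x k| + c * `|y k| <= 2^-1 -> `|u k y| <= 2^-1 ^+ k.+1) ->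
  continuous (fun y => limn (series (u ^~ y))).
Proof.
move=> c0 uc ub y0; apply/(@cvgrPdist_lt _ _ _ (nbhs y0) (nbhs_filter y0)) => e e0.
(* Half of the allowed 1/2 is spent at [y0]; the other 1/4 is left for the perturbation
   [c * |y0 - y|]. *)
have h40 : 0 < 2^-1 / 2 :> R[i] by rewrite divr_gt0// invr_gt0.
have [N _ small] : \forall k \near \oo, `|x k| + c * `|y0 k| <= 2^-1 / 2.
  have := near_ell1_small x (fun i : 'I_1 => c *: y0) h40.
  apply: filterS => k; rewrite big_ord1; apply: le_trans.
  by rewrite lerD2l -{1}(ger0_norm c0) -normrM.
have e30 : 0 < e / 3 by rewrite divr_gt0.
have [n [Nn ne]] : exists n, (N <= n)%N /\ 2^-1 ^+ n < e / 3.
  near \oo => n; exists n; split; near: n; first by exists N.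
  exact: near_half_expr_lt.
have sc : continuous (fun y => series (u ^~ y) n).
  by apply: continuous_big => [|i _]; [exact: add_continuous|exact: uc].
(* Dividing by [c + 1] rather than [c] covers [c = 0]. *)
have tail (y : ell1 R) : `|y0 - y| < 2^-1 / 2 / (c + 1) ->
    `|limn (series (u ^~ y)) - series (u ^~ y) n| < e / 3.
  move=> yy; apply: le_lt_trans ne; apply: series_half_tail => k nk.
  apply: ub; rewrite [leRHS]splitr.
  apply: (@le_trans _ _ (`|x k| + c * `|y0 k| + c * `|y0 - y|)).
    rewrite -addrA lerD2l -mulrDr ler_wpM2l//.
    rewrite -[y k](subKr (y0 k)) (le_trans (ler_normB _ _))// lerD2l.
    exact: (ell1_coord_le_norm (y0 - y) k).
  apply: lerD; first by apply: small; exact: leq_trans nk.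
  apply: (@le_trans _ _ ((c + 1) * `|y0 - y|)).
    by rewrite ler_wpM2r// lerDl.
  by rewrite mulrC -ler_pdivlMr ?ltW// ltr_wpDl.
near=> y.
(* Three thirds of [e]: the tail at [y0], the continuous partial sum of length [n], and the tail at
   [y]. *)
rewrite -(subrKA (series (u ^~ y0) n)) -[X in _ + X](subrKA (series (u ^~ y) n)).
rewrite [e](_ : _ = e / 3 + (e / 3 + e / 3)); last first.
  by rewrite -!mulr2n -mulrS -[_ *+ 3]mulr_natr divfK.
apply: (le_lt_trans (ler_normD _ _)); apply: ltrD.
  by apply: tail; rewrite subrr normr0 !divr_gt0// ltr_wpDl.
apply: (le_lt_trans (ler_normD _ _)); apply: ltrD.
  near: y.
  have /(@cvgrPdist_lt _ _ _ (nbhs y0) (nbhs_filter y0)) := sc y0; exact.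
rewrite distrC; apply: tail; near: y; apply: near_ell1_dist_lt.
by rewrite !divr_gt0// ltr_wpDl.
Unshelve. all: by end_near. Qed.

(** * Expansion of g(x + y) into homogeneous parts *)

(* The part of 2^(k+1) (x_k + y_k)^(2(k+1)) homogeneous of degree j in y,
   polarized; it vanishes for j > 2(k+1) thanks to the binomial coefficient,
   in spite of the truncated subtraction. *)
Definition expansion_term (R : realType) (j : nat) (x : ell1 R)
    (v : 'I_j -> ell1 R) (k : nat) : R[i] :=
  2 ^+ k.+1 *
  (x k ^+ (2 * k.+1 - j) * (\prod_(i < j) v i k) *+ 'C(2 * k.+1, j)).

(** The added terms have zero binomial coefficients. A range independent of the exponent can be
    split at any degree. *)
Lemma exprDn_wide (K : comNzRingType) (a b : K) (m n : nat) : (m < n)%N ->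
  (a + b) ^+ m = \sum_(0 <= j < n) a ^+ (m - j) * b ^+ j *+ 'C(m, j).
Proof.
move=> mn; rewrite (big_cat_nat (n := m.+1))//= -[LHS]addr0; congr (_ + _).
  by rewrite exprDn big_mkord.
by rewrite big_nat big1// => j /andP[mj _]; rewrite bin_small.
Qed.

(** From a <= 1/2 follows 2 a^2 <= 1/2; then take [k]-th powers. *)
Lemma double_expr_le_half (K : numFieldType) (a : K) (k : nat) :
  0 <= a -> a <= 2^-1 -> 2 ^+ k * a ^+ (2 * k) <= 2^-1 ^+ k.
Proof.
move=> a0 ah; rewrite exprM -exprMn lerXn2r ?nnegrE//.
  by rewrite mulr_ge0// exprn_ge0.
apply: (@le_trans _ _ (2 * 2^-1 ^+ 2)).
  by rewrite ler_pM2l// lerXn2r ?nnegrE ?invr_ge0.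
by rewrite expr2 mulrA divff// mul1r.
Qed.

(** Once the product is bounded by s^j, what remains is a single term of the binomial expansion of
    (|x_k| + s)^(2(k+1)), whose terms are all nonnegative. *)
Lemma expansion_term_le (R : realType) (j : nat) (x : ell1 R)
    (v : 'I_j -> ell1 R) (k : nat) :
  `|x k| + \sum_(i < j) `|v i k| <= 2^-1 ->
  `|expansion_term x v k| <= 2^-1 ^+ k.+1.
Proof.
set s := \sum_(i < j) _ => xs.
have s0 : 0 <= s by apply: sumr_ge0.
apply: le_trans (double_expr_le_half k.+1 (addr_ge0 (normr_ge0 (x k)) s0) xs).
rewrite /expansion_term normrM normrX ger0_norm// ler_pM2l ?exprn_gt0//.
rewrite normrMn normrM normrX normr_prod.
(* The widened range contains the index [j] even when [j] exceeds the degree. *)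
rewrite (@exprDn_wide _ _ _ _ (2 * k.+1 + j.+1)) ?addnS ?ltnS ?leq_addr//.
rewrite (bigD1_seq j) ?iota_uniq ?mem_index_iota//=; last first.
  by rewrite ltnS leq_addl.
apply: (@le_trans _ _ (`|x k| ^+ (2 * k.+1 - j) * s ^+ j *+ 'C(2 * k.+1, j))).
  rewrite lerMn2r ler_wpM2l ?orbT ?exprn_ge0//.
  rewrite -[X in s ^+ X](card_ord j) -prodr_const; apply: ler_prod => i _.
  by rewrite normr_ge0 /s (bigD1 i)//= lerDl sumr_ge0.
by rewrite lerDl sumr_ge0// => i _; rewrite mulrn_wge0// mulr_ge0// exprn_ge0.
Qed.

(** Only the binomial terms of degree at least [J] survive, and their absolute values are part of
    the expansion of (|x_k| + |y_k|)^(2(k+1)). The bound is uniform in [J], which justifies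
    exchanging the sums over [j] and [k]. *)
Lemma expansion_term_remainder_le (R : realType) (x y : ell1 R) (J k : nat) :
  `|x k| + `|y k| <= 2^-1 ->
  `|2 ^+ k.+1 * (x k + y k) ^+ (2 * k.+1) -
    \sum_(0 <= j < J) expansion_term x (fun _ : 'I_j => y) k| <= 2^-1 ^+ k.+1.
Proof.
move=> xy.
apply: le_trans
  (double_expr_le_half k.+1 (addr_ge0 (normr_ge0 (x k)) (normr_ge0 (y k))) xy).
have wide : (2 * k.+1 < 2 * k.+1 + J.+1)%N by rewrite addnS ltnS leq_addr.
have JW : (J <= 2 * k.+1 + J.+1)%N by rewrite addnS leqW// leq_addl.
rewrite !(exprDn_wide _ _ wide).
under [X in _ - X]eq_bigr do rewrite /expansion_term prodr_const card_ord.
rewrite -mulr_sumr -mulrBr normrM normrX ger0_norm// ler_pM2l ?exprn_gt0//.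
rewrite (big_cat_nat (n := J))//= addrAC subrr add0r.
rewrite [leRHS](big_cat_nat (n := J))//=.
apply: le_trans (ler_norm_sum _ _ _) _.
apply: (@le_trans _ _ (\sum_(J <= i < 2 * k.+1 + J.+1)
    `|x k| ^+ (2 * k.+1 - i) * `|y k| ^+ i *+ 'C(2 * k.+1, i))).
  by apply: ler_sum => i _; rewrite normrMn normrM !normrX.
by rewrite lerDr sumr_ge0// => i _; rewrite mulrn_wge0// mulr_ge0// exprn_ge0.
Qed.

Definition expansion (R : realType) (j : nat) (x : ell1 R)
    (v : 'I_j -> ell1 R) : R[i] := limn (series (expansion_term x v)).

Lemma expansion_cvg (R : realType) (j : nat) (x : ell1 R)
    (v : 'I_j -> ell1 R) :
  series (expansion_term x v) @ \oo --> expansion x v.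
Proof.
have h0 : 0 < 2^-1 :> R[i] by rewrite invr_gt0.
have [N _ small] := near_ell1_small x v h0.
by apply: (@cvg_series_half _ N) => k Nk; apply/expansion_term_le/small.
Qed.

Lemma expansion_multilinear (R : realType) (j : nat) (x : ell1 R) :
  multilinear (@expansion R j x).
Proof.
move=> v i a y z.
apply: (@cvg_lim R[i]) => //.
rewrite (_ : series _ = fun n => a * series (expansion_term x (dfwith v i y)) n
    + series (expansion_term x (dfwith v i z)) n); last first.
  apply/funext => n; rewrite /series /= mulr_sumr -big_split /=.
  apply: eq_bigr => k _; rewrite /expansion_term.
  rewrite !(bigD1 i (P := predT))//= !dfwithin.
  have E w : \prod_(l < j | l != i) (dfwith v i w : 'I_j -> ell1 R) l k =
      \prod_(l < j | l != i) v l k.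
    by apply: eq_bigr => l li; rewrite dfwithout// eq_sym.
  rewrite !E (_ : (a *: y + z) k = a * y k + z k)//.
  rewrite !mulrnAr -!mulrnDl; congr (_ *+ _).
  by rewrite !(mulrDl, mulrDr) !mulrA; congr (_ + _); rewrite !(mulrAC _ _ a) (mulrC a).
apply: (@cvgD R[i] R[i]); last exact: expansion_cvg.
by apply: (@cvgMl_tmp R[i]); exact: expansion_cvg.
Qed.

(** The difference is again a series over [k]: for large [J] its first [n] terms vanish, and the
    others sum to at most 2^-n. *)
Lemma g_ell1_expansion (R : realType) (x y : ell1 R) :
  series (fun j => expansion x (fun _ : 'I_j => y)) @ \oo --> g_ell1 (x + y).
Proof.
apply/cvgrPdist_le => e e0.
have h0 : 0 < 2^-1 :> R[i] by rewrite invr_gt0.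
have [N _ small] := near_ell1_small x (fun _ : 'I_1 => y) h0.
have [n [Nn ne]] : exists n, (N <= n)%N /\ 2^-1 ^+ n < e.
  near \oo => n; exists n; split; near: n; first by exists N.
  exact: near_half_expr_lt.
(* For [k < n] the degree 2(k+1) is at most 2n, hence below [J]: the truncated binomial sum is
   complete. *)
exists (2 * n).+1 => // J /= nJ.
pose D k : R[i] := 2 ^+ k.+1 * (x k + y k) ^+ (2 * k.+1) -
    \sum_(0 <= j < J) expansion_term x (fun _ : 'I_j => y) k.
have Dle k : (N <= k)%N -> `|D k| <= 2^-1 ^+ k.+1.
  move=> Nk; apply: expansion_term_remainder_le.
  by have := small _ Nk; rewrite big_ord1.
have Dcvg : series D @ \oo -->
    g_ell1 (x + y) - series (fun j => expansion x (fun _ : 'I_j => y)) J.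
  rewrite (_ : series D = fun m =>
      series (fun k => 2 ^+ k.+1 * (x + y) k ^+ (2 * k.+1)) m -
      \sum_(0 <= j < J) series (expansion_term x (fun _ : 'I_j => y)) m).
    apply: (@cvgB R[i] R[i]); first exact: g_ell1_cvg.
    apply: cvg_big; first exact: add_continuous.
    by move=> j _; exact: expansion_cvg.
  by apply/funext => m; rewrite /series /= [X in _ - X]exchange_big /= -sumrB.
have := @norm_lim_le _ R[i] (series D) _ 0 e Dcvg; rewrite subr0; apply.
exists n => // m /= nm; rewrite subr0.
rewrite -[series D m](subrK (series D n)) sub_series_geq//.
rewrite [series D n]big1_seq ?addr0; last first.
  move=> k; rewrite mem_index_iota => /andP[_ kn]; rewrite /D.
  have kJ : (2 * k.+1 < J)%N.
    by apply: leq_trans nJ; rewrite ltnS leq_pmul2l.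
  rewrite (exprDn_wide _ _ kJ) mulr_sumr; apply/eqP; rewrite subr_eq0; apply/eqP.
  by apply: eq_bigr => j _; rewrite /expansion_term prodr_const card_ord.
apply: le_trans (ler_norm_sum _ _ _) _.
apply: le_trans (ltW ne); apply: le_trans (sum_half_le _ n m).
rewrite !big_nat; apply: ler_sum => k /andP[nk _]; apply: Dle.
exact: leq_trans nk.
Unshelve. all: by end_near. Qed.

(** * Continuity of the homogeneous parts and of f *)

Lemma ptws_continuous (T : topologicalType) (I : topologicalType)
    (V : uniformType) (h : T -> {ptws I -> V}) :
  (forall i, continuous (fun x => h x i)) -> continuous h.
Proof. by move=> hc x; apply/(@pointwise_cvgP I V) => i; exact: hc. Qed.

Lemma ell1_coord_monomial_continuous (R : realType) (a : R[i]) (n k : nat) :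
  continuous (fun y : ell1 R => a * y k ^+ n).
Proof.
have yn : continuous (fun y : ell1 R => \prod_(i < n) y k).
  apply: continuous_big => [|i _]; first exact: (@mul_continuous R[i]).
  exact: ell1_coord_continuous.
move=> y; apply: (@continuous_comp _ _ _ (fun y : ell1 R => y k ^+ n)
  (fun z : R[i] => a * z)); last exact: (@mulrl_continuous R[i]).
rewrite (_ : (fun y => _) = fun y : ell1 R => \prod_(i < n) y k).
  exact: yn.
by apply/funext => z; rewrite prodr_const card_ord.
Qed.

Lemma expansion_continuous (R : realType) (j m : nat) (x : ell1 R) :
  continuous (fun y => expansion x (fun _ : 'I_j => m%:R *: y)).
Proof.
(* The constant comes from adding [j] copies of [|m * y k|]. *)
apply: (@series_continuous _ x (j%:R * m%:R)) => [|k|k y xy].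
- by rewrite mulr_ge0.
- rewrite (_ : (fun y => _) = fun y : ell1 R => (2 ^+ k.+1 *
      (x k ^+ (2 * k.+1 - j) * m%:R ^+ j *+ 'C(2 * k.+1, j))) * y k ^+ j).
    exact: ell1_coord_monomial_continuous.
  apply/funext => y; rewrite /expansion_term prodr_const card_ord.
  rewrite ell1_scaleE exprMn -!mulrA; congr (_ * _).
  by rewrite mulrnAl -!mulrA.
- apply: expansion_term_le; rewrite sumr_const card_ord -[_ *+ j]mulr_natl.
  by rewrite ell1_scaleE normrM normr_nat mulrA.
Qed.

Lemma f_ell1_continuous (R : realType) : continuous (@f_ell1 R).
Proof.
apply: (@ptws_continuous (ell1 R) nat R[i]) => n.
(* Here no base point is involved, so [x] is taken to be 0. *)
apply: (@series_continuous _ 0 n.+1%:R) => [|k|k y]; first by rewrite ler0n.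
- rewrite (_ : (fun y => _) = fun y : ell1 R =>
      (2 ^+ k.+1 * n.+1%:R ^+ (2 * k.+1)) * y k ^+ (2 * k.+1)).
    exact: ell1_coord_monomial_continuous.
  apply/funext => y; rewrite ell1_scaleE.
  by rewrite exprMn mulrA.
- rewrite (_ : (0 : ell1 R) k = 0)// normr0 add0r => yk.
  rewrite ell1_scaleE normrM !normrX normrM.
  by rewrite !normr_nat; apply: double_expr_le_half; rewrite ?mulr_ge0.
Qed.

(** * Unboundedness on non-empty open sets *)

(** The differences of the partial sums are constant once index [k] is included. *)
Lemma g_ell1_coord_change (R : realType) (x y : ell1 R) (k : nat) :
  (forall j, j != k -> x j = y j) ->
  g_ell1 x - g_ell1 y =
    2 ^+ k.+1 * (x k ^+ (2 * k.+1) - y k ^+ (2 * k.+1)).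
Proof.
move=> xy.
have gc : series (fun j => 2 ^+ j.+1 * x j ^+ (2 * j.+1)) n -
    series (fun j => 2 ^+ j.+1 * y j ^+ (2 * j.+1)) n @[n --> \oo] -->
    g_ell1 x - g_ell1 y.
  by apply: (@cvgB R[i] R[i]); exact: g_ell1_cvg.
rewrite -(@cvg_lim R[i] (@norm_hausdorff _ R[i]) _ _ _ _ _ gc).
apply: (@cvg_lim R[i] (@norm_hausdorff _ R[i])).
apply: (@cvg_near_cst nat R[i]).
exists k.+1 => // n /= kn; rewrite /series /= -sumrB.
rewrite (bigD1_seq k) ?iota_uniq ?mem_index_iota//= mulrBr big1 ?addr0// => j jk.
by rewrite xy// subrr.
Qed.

Lemma sum_normr_delta (K : numDomainType) (k n : nat) :
  \sum_(0 <= j < n) `|(j == k)%:R : K| = (k < n)%:R.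
Proof.
under eq_bigr do rewrite normr_nat.
elim: n => [|n ih]; first by rewrite big_geq.
by rewrite big_nat_recr//= ih ltnS -natrD; congr _%:R; case: ltngtP.
Qed.

Lemma normed_series_delta_cvg (R : realType) (k : nat) :
  [normed series (fun j => (j == k)%:R : R[i])] @ \oo --> (1 : R[i]).
Proof.
apply: (@cvg_near_cst nat R[i]).
by exists k.+1 => // n /= kn; rewrite /series /= sum_normr_delta kn.
Qed.

Lemma delta_abs_summable (R : realType) (k : nat) :
  (fun j => (j == k)%:R : R[i]) \in abs_summable.
Proof. by rewrite inE /=; exact: cvgP (@normed_series_delta_cvg R k). Qed.

Definition ell1_delta (R : realType) (k : nat) : ell1 R :=
  Ell1 (delta_abs_summable R k).

Lemma norm_ell1_delta (R : realType) (k : nat) : `|ell1_delta R k| = 1.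
Proof.
apply: (@cvg_lim R[i] (@norm_hausdorff _ R[i])).
exact: normed_series_delta_cvg.
Qed.

Lemma ptws_proj_continuous (I : topologicalType) (V : uniformType) (i : I) :
  continuous (fun h : {ptws I -> V} => h i).
Proof.
by move=> h; apply: (@pointwise_cvgP I V (nbhs h) h _).1; exact: cvg_id.
Qed.

Lemma tvs_bounded_ptws_coord (R : realType) (B : set {ptws nat -> R[i]})
    (n : nat) : tvs_bounded B ->
  exists2 r : R[i], 0 < r & forall h, B h -> `|h n| < r.
Proof.
(* Boundedness is tested on this cylinder: absorbing [B] into [r *: V] bounds coordinate [n] by
   [r]. *)
pose V := [set h : {ptws nat -> R[i]} | `|h n| < 1].
have V0 : nbhs (0 : {ptws nat -> R[i]}) V.
  have : nbhs ((0 : {ptws nat -> R[i]}) n) [set z : R[i] | `|z| < 1].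
    apply/nbhs_ballP; exists 1 => //= z; rewrite -ball_normE /= sub0r normrN.
    exact.
  exact: (@ptws_proj_continuous nat R[i]).
move=> /(_ V V0)[r r0 BV]; exists r => // h /BV[w Vw <-].
rewrite [ `|_| ](_ : _ = `|r * w n|)// normrM gtr0_norm//.
by rewrite -[ltRHS]mulr1 ltr_pM2l.
Qed.

Lemma f_ell1_unbounded (R : realType) (U : set (ell1 R)) :
  open U -> U !=set0 -> ~ tvs_bounded (@f_ell1 R @` U).
Proof.
move=> oU [x Ux] bU.
have /nbhs_ballP[e /= e0 eU] : nbhs x U by apply: open_nbhs_nbhs.
have e20 : 0 < e / 2 by rewrite divr_gt0.
have e40 : 0 < e / 2 / 2 by rewrite divr_gt0.
have h0 : 0 < 2^-1 :> R[i] by rewrite invr_gt0.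
have [m me] : exists m, 2^-1 ^+ m < e / 2.
  by near \oo => m; exists m; near: m; exact: near_half_expr_lt.
(* Coordinate [n] of f scales by [n.+1], so [c] is 2^m, and the choice of [m] gives c e/2 >= 1. *)
pose n := (2 ^ m).-1; pose c : R[i] := n.+1%:R.
have c0 : 0 < c by rewrite ltr0n.
have ce : 1 <= c * (e / 2).
  rewrite /c /n prednK ?expn_gt0// natrX -ler_pdivrMl ?exprn_gt0// mulr1 -exprVn.
  exact: ltW.
have [r r0 fr] := tvs_bounded_ptws_coord n bU.
have r1 : 0 < (r + r + 1)^-1 by rewrite invr_gt0 !addr_gt0.
near \oo => k.
have xk : `|x k| < e / 2 / 2 by near: k; exact: near_ell1_coord_lt.
have cxk : `|c * x k| < 2^-1.
  by near: k; exact: (near_ell1_coord_lt (c *: x)).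
have rk : 2^-1 ^+ k < (r + r + 1)^-1 by near: k; exact: near_half_expr_lt.
(* Coordinate [k] becomes e/2; since |x_k| < e/4, the distance to [x] is below 3e/4. *)
pose y := x + (e / 2 - x k) *: ell1_delta R k.
have yE j : y j = x j + (e / 2 - x k) * (j == k)%:R by [].
have Uy : U y.
  apply: eU; rewrite -ball_normE /= opprD addNKr normrN normrZ.
  apply: (@le_lt_trans _ _ `|e / 2 - x k|).
    by rewrite norm_ell1_delta mulr1.
  apply: (le_lt_trans (ler_normB _ _)); rewrite gtr0_norm//.
  rewrite [ltRHS]splitr ltrD2l (lt_trans xk)// [ltRHS]splitr ltrDl.
  exact: e40.
have fU z : U z -> `|g_ell1 (c *: z)| < r.
  by move=> Uz; apply: (fr (f_ell1 z)); exists z.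
have := @g_ell1_coord_change R (c *: y) (c *: x) k.
have -> : (c *: y) k = c * (e / 2).
  by rewrite [LHS](_ : _ = c * y k)// yE eqxx mulr1 addrC subrK.
have -> : (c *: x) k = c * x k by [].
have ey j : j != k -> (c *: y) j = (c *: x) j.
  move=> jk; rewrite [LHS](_ : _ = c * y j)// yE (negbTE jk) mulr0 addr0.
  by [].
move=> /(_ ey)/eqP; rewrite mulrBr eq_sym subr_eq => /eqP gE.
(* Both values of g are below [r] in modulus, and the old term at [k] is at most 1 because |c x_k| <
   1/2. *)
have : 2 ^+ k.+1 < r + r + 1 :> R[i].
  apply: (@le_lt_trans _ _ (2 ^+ k.+1 * (c * (e / 2)) ^+ (2 * k.+1))).
    by rewrite ler_peMr ?exprn_ge0// exprn_ege1.
  have c2 : 0 <= c * (e / 2) by rewrite mulr_ge0// ltW.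
  rewrite -[ltLHS]ger0_norm ?mulr_ge0 ?exprn_ge0// gE.
  apply: (le_lt_trans (ler_normD _ _)); apply: ltr_leD.
    apply: (le_lt_trans (ler_normB _ _)); apply: ltrD; exact: fU.
  rewrite normrM !normrX ger0_norm//.
  apply: le_trans (double_expr_le_half k.+1 (normr_ge0 _) (ltW cxk)) _.
  by rewrite exprn_ile1 ?invr_ge0// invf_le1 ?ler1n.
(* The order on [R[i]] is partial, so negating the strict inequality requires both sides to be real.
   The choice of [k] gives r + r + 1 <= 2^k. *)
rewrite -[X in _ -> X]/False; apply/negP; rewrite -real_leNgt; last first.
- exact: gtr0_real.
- by rewrite gtr0_real// !addr_gt0.
apply: (@le_trans _ _ (2 ^+ k)); last by rewrite exprS ler_peMl ?exprn_ge0 ?ler1n.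
by rewrite -lef_pV2 ?posrE ?exprn_gt0 ?addr_gt0// -exprVn ltW.
Unshelve. all: by end_near. Qed.

(** * Analyticity in the product space, coordinate by coordinate *)

Theorem proposition2p1 (R : realType) :
  complex_analytic [set: ell1 R] (@f_ell1 R) /\
  forall U : set (ell1 R), open U -> U !=set0 ->
    ~ tvs_bounded (@f_ell1 R @` U).
Proof.
split; last by move=> U; exact: f_ell1_unbounded.
split; first exact: openT.
  by apply: continuous_subspaceT; exact: f_ell1_continuous.
move=> x _; exists setT, (fun j y n =>
  expansion (n.+1%:R *: x) (fun _ : 'I_j => n.+1%:R *: y)); split => //.
- exact: filterT.
- move=> j; split; last first.
    apply: (@ptws_continuous (ell1 R) nat R[i]) => n.
    exact: expansion_continuous.
  exists (fun v n => expansion (n.+1%:R *: x) (fun i : 'I_j => n.+1%:R *: v i)).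
    move=> v i a y z; apply/funext => n /=.
    (* Scaling all arguments by [n.+1] commutes with replacing one of them, so multilinearity passes
       to each coordinate. *)
    have dfwithZ w : (fun l => n.+1%:R *: dfwith v i w l) =
        dfwith (fun l => n.+1%:R *: v l) i (n.+1%:R *: w).
      apply/funext => l; have [<-|li] := eqVneq i l; first by rewrite !dfwithin.
      by rewrite !dfwithout.
    rewrite dfwithZ scalerDr scalerA mulrC -scalerA expansion_multilinear.
    by rewrite -!dfwithZ.
  by [].
- move=> y _; apply/(@pointwise_cvgP nat R[i]) => n.
  rewrite /f_ell1 scalerDr; have := @g_ell1_expansion R (n.+1%:R *: x) (n.+1%:R *: y).
  rewrite (_ : series _ = fun J => series (fun j m =>
      expansion (m.+1%:R *: x) (fun _ : 'I_j => m.+1%:R *: y)) J n); first exact.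
  apply/funext => J.
  rewrite /series /=; elim: J => [|J ih]; first by rewrite !big_geq.
  by rewrite !big_nat_recr//= ih.
Qed.
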